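(* If $G_1$ and $G_2$ are 3-balanced finite graphs, then so are their Cartesian product $G_1\Box G_2$, their tensor product $G_1\times G_2$, and their strong product $G_1\boxtimes G_2$.
   Context: A graph is 3-balanced if it admits a vertex coloring $\ell:V\to\mathbb{Z}_3$ such that every vertex has, in its open neighborhood, the same number of vertices of each of the three colors. All three products have vertex set $V(G_1)\times V(G_2)$; in $G_1\Box G_2$, $(u,v)\sim(u',v')$ iff ($u=u'$ and $vv'\in E(G_2)$) or ($v=v'$ and $uu'\in E(G_1)$); in $G_1\times G_2$, $(u,v)\sim(u',v')$ iff $uu'\in E(G_1)$ and $vv'\in E(G_2)$; the edge set of $G_1\boxtimes G_2$ is the union of those of $G_1\Box G_2$ and $G_1\times G_2$. *)

(* Defs.v *)
From HB Require Import structures.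
From mathcomp Require Import all_boot all_order all_algebra.

Set Implicit Arguments.
Unset Strict Implicit.
Unset Printing Implicit Defensive.

Record sgraph := SGraph {
  vertex :> finType;
  adj : rel vertex;
  adj_sym : symmetric adj;
  adj_irr : irreflexive adj }.

Definition open_nbhd (G : sgraph) (v : G) : {set G} := [set u | adj v u].

Definition balanced_coloring (G : sgraph) (l : G -> 'Z_3) : Prop :=
  forall (v : G) (i j : 'Z_3),
    #|[set u in open_nbhd v | l u == i]| = #|[set u in open_nbhd v | l u == j]|.

Definition balanced3 (G : sgraph) : Prop :=
  exists l : G -> 'Z_3, balanced_coloring l.

Section Products.
Variables G1 G2 : sgraph.

Definition cart_adj : rel (G1 * G2) := fun x y =>
  ((x.1 == y.1) && adj x.2 y.2) || ((x.2 == y.2) && adj x.1 y.1).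

Definition tensor_adj : rel (G1 * G2) := fun x y =>
  adj x.1 y.1 && adj x.2 y.2.

Definition strong_adj : rel (G1 * G2) := fun x y =>
  cart_adj x y || tensor_adj x y.

Lemma cart_adj_sym : symmetric cart_adj.
Proof.
move=> x y; rewrite /cart_adj (eq_sym x.1) (eq_sym x.2).
by rewrite (adj_sym x.1) (adj_sym x.2).
Qed.

Lemma cart_adj_irr : irreflexive cart_adj.
Proof. by move=> x; rewrite /cart_adj !adj_irr !andbF. Qed.

Lemma tensor_adj_sym : symmetric tensor_adj.
Proof. by move=> x y; rewrite /tensor_adj (adj_sym x.1) (adj_sym x.2). Qed.

Lemma tensor_adj_irr : irreflexive tensor_adj.
Proof. by move=> x; rewrite /tensor_adj adj_irr. Qed.

Lemma strong_adj_sym : symmetric strong_adj.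
Proof. by move=> x y; rewrite /strong_adj cart_adj_sym tensor_adj_sym. Qed.

Lemma strong_adj_irr : irreflexive strong_adj.
Proof. by move=> x; rewrite /strong_adj cart_adj_irr tensor_adj_irr. Qed.

Definition cartesian_product : sgraph := SGraph cart_adj_sym cart_adj_irr.
Definition tensor_product : sgraph := SGraph tensor_adj_sym tensor_adj_irr.
Definition strong_product : sgraph := SGraph strong_adj_sym strong_adj_irr.

End Products.

(* Main.v *)
Require Import Defs.
From HB Require Import structures.
From mathcomp Require Import all_boot all_order all_algebra.

(** If [l1] and [l2] are balanced colorings, then [(u, v) |-> l1 u + l2 v] is
    balanced for all three products: every neighborhood is a disjoint union of
    rectangles [A x B] in which [A] or [B] is a neighborhood in a factor. Along
    the slices in that direction the coloring is a translate of a balanced one. *)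

Import GRing.Theory.
Local Open Scope ring_scope.

(** The balance condition for an arbitrary set, so that it can be stated for pieces of a
    neighborhood. At [open_nbhd v] it is convertible to the condition in [balanced_coloring]. *)
Definition equidistributed {T : finType} {V : eqType} (f : T -> V)
    (A : {set T}) : Prop :=
  forall i j : V, #|[set u in A | f u == i]| = #|[set u in A | f u == j]|.

Lemma equidistributedU {T : finType} {V : eqType} {f : T -> V}
    {A B : {set T}} :
  [disjoint A & B] -> equidistributed f A -> equidistributed f B ->
  equidistributed f (A :|: B).
Proof.
move=> dAB fA fB.
suff cardU k : #|[set u in A :|: B | f u == k]| =
    (#|[set u in A | f u == k]| + #|[set u in B | f u == k]|)%N.
  by move=> i j; rewrite !cardU (fA i j) (fB i j).
(* The inclusion-exclusion correction regroups to contain [A :&: B], hence vanishes. *)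
rewrite !setIdE setIUl cardsU setIACA (disjoint_setI0 dAB) set0I.
by rewrite cards0 subn0.
Qed.

Section SumColoring.
Context {T1 T2 : finType} {V : zmodType} {f : T1 -> V} {g : T2 -> V}.
Context {A : {set T1}} {B : {set T2}}.

Let sum_coloring (x : T1 * T2) : V := f x.1 + g x.2.

(** For fixed [a], color [k] on the slice means [g b = k - f a]; by balance of [g] on [B], the size
    of this class does not depend on [k]. *)
Lemma equidistributed_setXr :
  equidistributed g B -> equidistributed sum_coloring (setX A B).
Proof.
move=> gB.
suff slice k : #|[set x in setX A B | sum_coloring x == k]| =
    (\sum_(a in A) #|[set b in B | g b == (k - f a)%R]|)%N.
  by move=> i j; rewrite !slice; apply: eq_bigr => a _; apply: gB.
under eq_bigr => a _ do rewrite -sum1_card.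
rewrite -sum1_card pair_big_dep /=; apply: eq_bigl => -[a b].
by rewrite !inE /= -andbA [g b == _]eq_sym subr_eq eq_sym addrC.
Qed.

Lemma equidistributed_setXl :
  equidistributed f A -> equidistributed sum_coloring (setX A B).
Proof.
move=> fA.
suff slice k : #|[set x in setX A B | sum_coloring x == k]| =
    (\sum_(b in B) #|[set a in A | f a == (k - g b)%R]|)%N.
  by move=> i j; rewrite !slice; apply: eq_bigr => b _; apply: fA.
under eq_bigr => b _ do rewrite -sum1_card.
(* The slices are now indexed by the second coordinate, so the sums are swapped to match the order
   of pairs in [T1 * T2]. *)
rewrite -sum1_card (exchange_big_dep (mem A)) /=; last first.
  by move=> b a _; rewrite inE => /andP[].
rewrite pair_big_dep /=; apply: eq_bigl => -[a b].
rewrite !inE /= [f a == _]eq_sym subr_eq eq_sym.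
by case: (a \in A).
Qed.

End SumColoring.

Section Neighborhoods.
Variables (G1 G2 : sgraph) (x : G1 * G2).

Lemma open_nbhd_tensor :
  @open_nbhd (tensor_product G1 G2) x =
    setX (open_nbhd x.1) (open_nbhd x.2).
Proof. by apply/setP => -[a b]; rewrite !inE. Qed.

Lemma open_nbhd_cart :
  @open_nbhd (cartesian_product G1 G2) x =
    setX [set x.1] (open_nbhd x.2) :|: setX (open_nbhd x.1) [set x.2].
Proof.
apply/setP => -[a b]; rewrite !inE /= /cart_adj /=.
by rewrite (eq_sym a) (eq_sym b) [X in _ || X]andbC.
Qed.

Lemma open_nbhd_strong :
  @open_nbhd (strong_product G1 G2) x =
    @open_nbhd (cartesian_product G1 G2) x :|:
    @open_nbhd (tensor_product G1 G2) x.
Proof. by apply/setP => y; rewrite !inE. Qed.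

(** A common point would have first coordinate [x.1] and also be adjacent to [x.1] there. *)
Lemma cart_parts_disjoint :
  [disjoint setX [set x.1] (open_nbhd x.2)
          & setX (open_nbhd x.1) [set x.2]].
Proof.
rewrite -setI_eq0; apply/eqP/setP => -[a b]; rewrite !inE /=.
by have [->|] := eqVneq a x.1; rewrite ?adj_irr ?andbF.
Qed.

(** A Cartesian neighbor shares a coordinate with [x], while a tensor neighbor is adjacent to [x] in
    both, which irreflexivity forbids. *)
Lemma cart_tensor_disjoint :
  [disjoint @open_nbhd (cartesian_product G1 G2) x
          & @open_nbhd (tensor_product G1 G2) x].
Proof.
rewrite -setI_eq0; apply/eqP/setP => -[a b].
rewrite !inE /= /cart_adj /tensor_adj /=.
have [<-|_] := eqVneq x.1 a; first by rewrite adj_irr /= andbF.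
by have [<-|//] := eqVneq x.2 b; rewrite adj_irr !andbF.
Qed.

End Neighborhoods.

Theorem theorem6p7 (G1 G2 : sgraph) :
  balanced3 G1 -> balanced3 G2 ->
  [/\ balanced3 (cartesian_product G1 G2),
      balanced3 (tensor_product G1 G2)
    & balanced3 (strong_product G1 G2)].
Proof.
move=> [l1 bal1] [l2 bal2].
pose l (x : G1 * G2) : 'Z_3 := l1 x.1 + l2 x.2.
have tensorP x : equidistributed l (@open_nbhd (tensor_product G1 G2) x).
  by rewrite open_nbhd_tensor; exact: equidistributed_setXr (bal2 x.2).
have cartP x : equidistributed l (@open_nbhd (cartesian_product G1 G2) x).
  rewrite open_nbhd_cart; apply: equidistributedU.
  - exact: cart_parts_disjoint.
  (* Each rectangle is sliced along the factor in which it is a neighborhood, the other side being a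
     singleton. *)
  - exact: equidistributed_setXr (bal2 x.2).
  - exact: equidistributed_setXl (bal1 x.1).
split; exists l => x.
- exact: cartP.
- exact: tensorP.
rewrite open_nbhd_strong.
exact: equidistributedU (cart_tensor_disjoint _ _ x) (cartP x) (tensorP x).
Qed.
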